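(* Let $\mathbf{A}\in\mathbb{C}^{n\times n}$ be invertible Hermitian with $\|\mathbf{A}\|\le1$ and $\epsilon\in(0,1/2)$. Algorithm $\mathsf{EVALSH}\text{-}\mathsf{REL}(\mathbf{A},\epsilon)$: set $\delta=1/2$ and $(\widetilde\lambda_1,\dots,\widetilde\lambda_n)=\mathsf{EVALSH}(\mathbf{A},\delta)$; while $\delta\ge\frac{\epsilon}{1+\epsilon}\min_i|\widetilde\lambda_i|$, set $\delta\leftarrow\delta/2$ and recompute $(\widetilde\lambda_1,\dots,\widetilde\lambda_n)=\mathsf{EVALSH}(\mathbf{A},\delta)$; return $\widetilde\lambda_1,\dots,\widetilde\lambda_n$. Then: (i) on success, with eigenvalues and approximations both listed in nondecreasing order, $|\widetilde\lambda_i-\lambda_i(\mathbf{A})|\le\epsilon\min_{\lambda\in\Lambda(\mathbf{A})}|\lambda|\le\epsilon|\lambda_i(\mathbf{A})|$ for all $i$; (ii) the arithmetic complexity is $O\big(T_{\mathsf{MM}}(n)\log^2(\tfrac{n\|\mathbf{A}^{-1}\|}{\epsilon})\log(\tfrac{\|\mathbf{A}^{-1}\|}{\epsilon})\big)$; (iii) the success probability is at least $1-O\big(\log(\|\mathbf{A}^{-1}\|/\epsilon)/n\big)$; (iv) it requires $O\big(\log^4(n\|\mathbf{A}^{-1}\|/\epsilon)\log n\big)$ bits of precision.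
   Context: Floating point model with unit roundoff $\mathbf{u}$ ($\mathrm{fl}(a\odot b)=(1+\delta)(a\odot b)$, $|\delta|\le\mathbf{u}$). $T_{\mathsf{MM}}(n)=O(n^{\omega+\eta})$ is the cost of stable fast matrix multiplication. $\Lambda(\mathbf{A})$ is the spectrum. $\mathsf{EVALSH}(\mathbf{A},\delta)$ is a randomized algorithm which, for Hermitian $\mathbf{A}$ with $\|\mathbf{A}\|\le1$ and $\delta\in(0,1/2)$, returns $n$ real values which, listed in nondecreasing order, are each within $\delta$ of the correspondingly ordered eigenvalues of $\mathbf{A}$, with probability at least $1-17/n$, using $O(T_{\mathsf{MM}}(n)\log^2(n/\delta))$ arithmetic operations and $O(\log^4(n/\delta)\log n)$ bits of precision (it is built from a Hermitian GUE-type random perturbation followed by a backward-stable diagonalization routine).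
   Formalization: The EVALSH guarantee is assumed also at δ = 1/2 (the first call), the complexity bound (ii) is stated for successful runs, since failed calls may make the loop run forever, and the loop test and halving are carried out exactly; T_MM(n) is taken to be at least of order n. *)

(* Defs.v *)
From HB Require Import structures.
From mathcomp Require Import all_boot all_order all_algebra.
From mathcomp Require Import sesquilinear spectral.
From mathcomp Require Import all_classical all_reals all_analysis.
From mathcomp Require Import complex.

Set Implicit Arguments.
Unset Strict Implicit.
Unset Printing Implicit Defensive.

Import Order.TTheory GRing.Theory Num.Theory.

Local Open Scope classical_set_scope.
Local Open Scope ring_scope.
Local Open Scope complex_scope.

Definition l2norm (R : realType) (n : nat) (x : 'cV[R[i]]_n) : R :=
  Num.sqrt (\sum_(i < n) Normc.normc (x i 0) ^+ 2).

Definition opnorm (R : realType) (n : nat) (A : 'M[R[i]]_n) : R :=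
  sup [set l2norm (A *m x) | x in [set x : 'cV[R[i]]_n | l2norm x <= 1]].

(* The roots of the characteristic polynomial, listed with multiplicity. *)
Definition spectrum (R : realType) (n : nat) (A : 'M[R[i]]_n) : seq R[i] :=
  sval (closed_field_poly_normal (char_poly A)).

(* lambda_1(A) <= ... <= lambda_n(A). Only meant for Hermitian A, whose        *)
(* spectrum is real, so that taking real parts loses nothing.                 *)
Definition eigenvalues (R : realType) (n : nat) (A : 'M[R[i]]_n) : seq R :=
  sort <=%R [seq complex.Re z | z <- spectrum A].

(* The minimum of a nonempty sequence: the default value is one of its items. *)
Definition seq_min (R : realType) (s : seq R) : R :=
  \big[Num.min/head 0 s]_(x <- s) x.

Definition min_abs (R : realType) (n : nat) (v : n.-tuple R) : R :=
  seq_min [seq `|x| | x <- v].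

Definition min_abs_spectrum (R : realType) (n : nat) (A : 'M[R[i]]_n) : R :=
  seq_min [seq Normc.normc z | z <- spectrum A].

Definition accurate (R : realType) (n : nat) (A : 'M[R[i]]_n) (delta : R)
    (v : n.-tuple R) : Prop :=
  forall i : 'I_n, `|(sort <=%R v)`_i - (eigenvalues A)`_i| <= delta.

(* Q holds with probability at least p. For a measurable Q this is just       *)
(* p <= P Q; stating it through a measurable subset avoids measurability      *)
(* assumptions on the algorithms below.                                       *)
Definition with_prob_ge (R : realType) (d : measure_display)
    (T : measurableType d) (P : probability T R) (p : R) (Q : set T) : Prop :=
  exists E : set T, [/\ measurable E, E `<=` Q & (p%:E <= P E)%E].

(* Bits of precision of floating point arithmetic with unit roundoff u.       *)
Definition precision_bits (R : realType) (u : R) : R := ln u^-1 / ln 2.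

(* A randomized floating point eigenvalue routine, as a function of the       *)
(* dimension n, the unit roundoff u, the matrix, the accuracy delta and a     *)
(* random seed. It returns n real values and the number of arithmetic         *)
(* operations performed.                                                      *)
Definition eig_routine (R : realType) (S : Type) : Type :=
  forall n : nat, R -> 'M[R[i]]_n -> R -> S -> n.-tuple R * nat.

(* T is O(n^(omega + eta)), and at least linear (any multiplication algorithm *)
(* produces n^2 entries).                                                     *)
Definition mm_cost (R : realType) (n0 : nat) (omega eta : R) (T : nat -> R)
    : Prop :=
  (exists C : R, forall n, (n0 <= n)%N -> T n <= C * n%:R `^ (omega + eta)) /\
  (exists2 C : R, 0 < C & forall n, (n0 <= n)%N -> n%:R <= C * T n).

(* The guarantees of EVALSH. All O(.) constants are uniform in the dimension  *)
(* n >= n0, the matrix, the accuracy and the unit roundoff; needing O(B) bits  *)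
(* of precision means that C * B bits are enough for some constant C. The     *)
(* threshold n0 lets one exclude n = 1, where log n = 0. The accuracy 1/2 is  *)
(* included since it is the first one requested by EVALSH-REL.                *)
Definition evalsh_spec (R : realType) (d : measure_display)
    (S : measurableType d) (mu : probability S R) (n0 : nat) (T : nat -> R)
    (EVALSH : eig_routine R S) : Prop :=
  exists Cops Cbits : R,
  forall (n : nat) (A : 'M[R[i]]_n) (delta u : R),
    (n0 <= n)%N -> A \is hermsymmx -> opnorm A <= 1 ->
    0 < delta <= 2^-1 -> 0 < u < 1 ->
    Cbits * (ln (n%:R / delta) ^+ 4 * ln n%:R) <= precision_bits u ->
    (forall s : S, (EVALSH n u A delta s).2%:R
                     <= Cops * (T n * ln (n%:R / delta) ^+ 2)) /\
    with_prob_ge mu (1 - 17 / n%:R)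
      [set s | accurate A delta (EVALSH n u A delta s).1].

(* A terminated run of EVALSH-REL: the returned values, the (accuracy,        *)
(* returned values) pairs of all the calls to EVALSH, and the total number of *)
(* arithmetic operations.                                                     *)
Record execution (R : realType) (n : nat) := Execution {
  output : n.-tuple R ;
  calls : seq (R * n.-tuple R) ;
  ops : nat }.

(* Operations of one loop test delta >= eps / (1 + eps) * min_i |v_i|:        *)
(* n absolute values, n - 1 comparisons, one addition, division,              *)
(* multiplication and comparison.                                             *)
Definition test_ops (n : nat) : nat := (2 * n + 3)%N.

(* Big-step semantics of the loop, entered at accuracy delta. The k-th call   *)
(* uses the seed xi k. A non-terminating run has no execution.                *)
Inductive evalsh_rel_loop (R : realType) (S : Type) (EVALSH : eig_routine R S)
    (n : nat) (u : R) (A : 'M[R[i]]_n) (eps : R) (xi : nat -> S)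
    : nat -> R -> execution R n -> Prop :=
| Loop_exit (k : nat) (delta : R) (v : n.-tuple R) (c : nat) :
    EVALSH n u A delta (xi k) = (v, c) ->
    delta < eps / (1 + eps) * min_abs v ->
    evalsh_rel_loop EVALSH u A eps xi k delta
      (Execution v [:: (delta, v)] (c + test_ops n)%N)
| Loop_continue (k : nat) (delta : R) (v : n.-tuple R) (c : nat)
    (e : execution R n) :
    EVALSH n u A delta (xi k) = (v, c) ->
    eps / (1 + eps) * min_abs v <= delta ->
    evalsh_rel_loop EVALSH u A eps xi k.+1 (delta / 2) e ->
    evalsh_rel_loop EVALSH u A eps xi k delta
      (Execution (output e) ((delta, v) :: calls e)
         (c + test_ops n + 1 + ops e)%N).

Definition evalsh_rel (R : realType) (S : Type) (EVALSH : eig_routine R S)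
    (n : nat) (u : R) (A : 'M[R[i]]_n) (eps : R) (xi : nat -> S)
    (e : execution R n) : Prop :=
  evalsh_rel_loop EVALSH u A eps xi 0 2^-1 e.

Definition successful (R : realType) (n : nat) (A : 'M[R[i]]_n)
    (e : execution R n) : Prop :=
  forall c : R * n.-tuple R, c \in calls e -> accurate A c.1 c.2.

(* Main.v *)
Require Import Defs.
From HB Require Import structures.
From mathcomp Require Import all_boot all_order all_algebra.
From mathcomp Require Import sesquilinear spectral.
From mathcomp Require Import all_classical all_reals all_analysis.
From mathcomp Require Import complex.
From mathcomp Require Import ring lra.

Import Order.TTheory GRing.Theory Num.Theory.

Local Open Scope classical_set_scope.
Local Open Scope ring_scope.
Local Open Scope complex_scope.

(** Let [m] be the smallest modulus of an eigenvalue of the Hermitian matrix [A],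
    so that [1 / m <= ||A^-1||] and [m <= ||A|| <= 1]. An accurate call at
    accuracy [delta] returns values whose smallest modulus is within [delta] of
    [m]. Hence passing the exit test forces [delta < eps * m], which is the
    relative accuracy, while failing it forces [eps * m <= 2 * delta]. All
    requested accuracies of a successful run are therefore at least
    [eps / (4 ||A^-1||)], and there are [O(log (||A^-1|| / eps))] of them; the
    cost is the sum over the calls and the failure probability follows from
    the union bound over them. *)

(** * Complex moduli, the Euclidean norm and the operator norm *)

Section MatrixNorm.
Variable R : realType.
Implicit Types (n : nat) (z : R[i]).

Lemma normc_ge0 z : 0 <= Normc.normc z.
Proof. by case: z => a b; exact: sqrtr_ge0. Qed.

Lemma normc_eq0 z : (Normc.normc z == 0) = (z == 0).
Proof.
by apply/eqP/eqP => [/Normc.eq0_normc//|->]; rewrite Normc.normc0.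
Qed.

Lemma normc_real z : z \is Num.real -> Normc.normc z = `|complex.Re z|.
Proof.
move=> /complex_realP [r ->] /=.
by rewrite expr0n addr0 sqrtr_sqr.
Qed.

Lemma normc_sum n (F : 'I_n -> R[i]) :
  Normc.normc (\sum_(i < n) F i) <= \sum_(i < n) Normc.normc (F i).
Proof.
elim/big_ind2 : _ => [|x1 x2 y1 y2 h1 h2|//]; first by rewrite Normc.normc0.
exact: le_trans (le_normcD _ _) (lerD h1 h2).
Qed.

Lemma l2norm_ge0 n (x : 'cV[R[i]]_n) : 0 <= l2norm x.
Proof. exact: sqrtr_ge0. Qed.

Lemma l2norm_sumsqr_ge0 n (x : 'cV[R[i]]_n) :
  0 <= \sum_(i < n) Normc.normc (x i 0) ^+ 2.
Proof. by apply: sumr_ge0 => i _; rewrite sqr_ge0. Qed.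

Lemma normc_le_l2norm n (x : 'cV[R[i]]_n) i : Normc.normc (x i 0) <= l2norm x.
Proof.
rewrite -[leLHS]ger0_norm ?normc_ge0// -sqrtr_sqr ler_sqrt ?l2norm_sumsqr_ge0//.
by rewrite (bigD1 i)//= lerDl sumr_ge0// => j _; rewrite sqr_ge0.
Qed.

Lemma l2norm_eq0 n (x : 'cV[R[i]]_n) : l2norm x = 0 -> x = 0.
Proof.
move=> x0; apply/colP => i; rewrite mxE; apply/eqP.
by rewrite -normc_eq0 eq_le normc_ge0 andbT -x0 normc_le_l2norm.
Qed.

Lemma l2normZ n a (x : 'cV[R[i]]_n) : l2norm (a *: x) = Normc.normc a * l2norm x.
Proof.
rewrite /l2norm; under eq_bigr do rewrite mxE Normc.normcM exprMn.
by rewrite -mulr_sumr sqrtrM ?sqr_ge0// sqrtr_sqr ger0_norm ?normc_ge0.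
Qed.

(** Makes the supremum in [opnorm] meaningful. On the unit ball every coordinate has modulus at most
    1, so each coordinate of [A *m x] is at most a row sum of moduli. *)
Lemma opnorm_has_ubound n (A : 'M[R[i]]_n) :
  has_ubound [set l2norm (A *m x) | x in [set x : 'cV[R[i]]_n | l2norm x <= 1]].
Proof.
exists (Num.sqrt (\sum_i (\sum_j Normc.normc (A i j)) ^+ 2)) => _ [x /= x1 <-].
rewrite /l2norm ler_sqrt; last by apply: sumr_ge0 => i _; rewrite sqr_ge0.
apply: ler_sum => i _; rewrite lerXn2r ?nnegrE ?normc_ge0//.
  by apply: sumr_ge0 => j _; exact: normc_ge0.
rewrite mxE; apply: le_trans (normc_sum _ _) _; apply: ler_sum => j _.
by rewrite Normc.normcM ler_piMr ?normc_ge0// (le_trans (normc_le_l2norm _ _ _)).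
Qed.

Lemma normc_eigenvalue_le_opnorm n (A : 'M[R[i]]_n) (x : 'cV[R[i]]_n) a :
  x != 0 -> A *m x = a *: x -> Normc.normc a <= opnorm A.
Proof.
move=> x0 Ax.
have nx : l2norm x != 0 by apply: contra x0 => /eqP/l2norm_eq0/eqP.
have nC : Normc.normc ((l2norm x)^-1)%:C = (l2norm x)^-1.
  by rewrite /= expr0n addr0 sqrtr_sqr ger0_norm// invr_ge0 l2norm_ge0.
apply: (ub_le_sup (opnorm_has_ubound n A)).
exists (((l2norm x)^-1)%:C *: x) => /=; first by rewrite l2normZ nC mulVf.
by rewrite -scalemxAr Ax !l2normZ nC mulrCA mulVf// mulr1.
Qed.

End MatrixNorm.

(** * Spectrum of a Hermitian matrix and of its inverse *)

Section HermitianSpectrum.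
Variables (R : realType) (n : nat) (A : 'M[R[i]]_n).
Hypothesis Aherm : A \is hermsymmx.

Lemma size_spectrum : size (spectrum A) = n.
Proof.
rewrite /spectrum; case: closed_field_poly_normal => s /= hs.
have := size_char_poly A; rewrite hs (monicP (char_poly_monic A)) scale1r.
by rewrite size_prod_XsubC => -[].
Qed.

Lemma eigenvalue_spectrum z : z \in spectrum A -> eigenvalue A z.
Proof.
rewrite eigenvalue_root_char /spectrum.
case: closed_field_poly_normal => s /= ->.
by rewrite (monicP (char_poly_monic A)) scale1r root_prod_XsubC.
Qed.

(** [eigenvalue] provides a row eigenvector [v], whereas [opnorm] acts on columns; the conjugate
    transpose of [v] is a column eigenvector for the conjugate of [z]. *)
Lemma hermitian_eigenvector z : z \in spectrum A ->
  z \is Num.real /\ exists2 x : 'cV[R[i]]_n, x != 0 & A *m x = z *: x.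
Proof.
move=> /eigenvalue_spectrum /eigenvalueP [v vA v0].
pose x : 'cV[R[i]]_n := (map_mx Num.conj v)^T.
have Asym i j : A i j = Num.conj (A j i).
  by have /is_hermitianmxP := Aherm; rewrite expr0 scale1r => {1}->; rewrite !mxE.
have Ax : A *m x = Num.conj z *: x.
  apply/colP => i; rewrite !mxE -rmorphM.
  have /rowP/(_ i) := vA; rewrite !mxE => <-; rewrite rmorph_sum/=.
  by apply: eq_bigr => j _; rewrite !mxE rmorphM/= Asym mulrC.
(* This entry is the sum of the squared moduli of the entries of [v]. *)
have vx0 : (v *m x) 0 0 != 0.
  rewrite mxE; under eq_bigr do rewrite !mxE -normCK.
  apply: contra v0; rewrite psumr_eq0 => [/allP/= vi0|i _]; last first.
    by rewrite exprn_ge0.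
  apply/eqP/rowP => i; rewrite mxE; apply/eqP.
  by have := vi0 i (mem_index_enum _); rewrite sqrf_eq0 normr_eq0.
(* Evaluating [v *m A *m x] from both sides gives [z] and its conjugate times the same nonzero
   scalar. *)
have zreal : Num.conj z = z.
  apply: (mulIf vx0); have := mulmxA v A x.
  by rewrite vA Ax -scalemxAr -scalemxAl => /matrixP/(_ 0 0); rewrite !mxE.
split; first exact/CrealP.
exists x; last by rewrite Ax zreal.
by apply: contra vx0 => /eqP ->; rewrite mulmx0 mxE.
Qed.

Lemma size_eigenvalues : size (eigenvalues A) = n.
Proof. by rewrite size_sort size_map size_spectrum. Qed.

Lemma normc_spectrum_le_opnorm z : z \in spectrum A -> Normc.normc z <= opnorm A.
Proof.
by move=> /hermitian_eigenvector [_ [x x0 /(normc_eigenvalue_le_opnorm _ _ _ _ _ x0)]].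
Qed.

(** An eigenvector of [A] for [z] is one of [invmx A] for the inverse of [z]. *)
Lemma inv_normc_spectrum_le_opnorm_invmx z : A \in unitmx -> z \in spectrum A ->
  0 < Normc.normc z /\ (Normc.normc z)^-1 <= opnorm (invmx A).
Proof.
move=> Aunit /hermitian_eigenvector [_ [x x0 Ax]].
have xE : x = z *: (invmx A *m x) by rewrite scalemxAr -Ax mulKmx.
have z0 : z != 0 by apply: contra x0 => /eqP z0; rewrite xE z0 scale0r.
split; first by rewrite lt_def normc_eq0 z0 normc_ge0.
rewrite -Normc.normcV; apply: (normc_eigenvalue_le_opnorm _ _ _ _ _ x0).
by rewrite {2}xE scalerA mulVf// scale1r.
Qed.

End HermitianSpectrum.

(** * Minimum of a sequence *)

Section SeqMin.
Variable R : realType.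
Implicit Types s : seq R.

Lemma seq_min_le s x : x \in s -> seq_min s <= x.
Proof.
(* The default is generalised, since the head changes along the induction. *)
rewrite /seq_min; elim: s (head 0 s) => //= a s IH d.
by rewrite inE big_cons ge_min => /predU1P [->|/IH ->]; rewrite ?lexx ?orbT.
Qed.

Lemma seq_min_mem s : (0 < size s)%N -> seq_min s \in s.
Proof.
case: s => // a s _; rewrite /seq_min /=.
(* The induction runs over the folded list only; the default [a] and the ambient list stay fixed. *)
have : {subset a :: s <= a :: s} by [].
elim: {1 3}(a :: s) => [|b t IH] sub; first by rewrite big_nil mem_head.
rewrite big_cons minEle; case: ifP => _; first by rewrite sub ?mem_head.
by apply: IH => y yt; rewrite sub// inE yt orbT.
Qed.

End SeqMin.

(** * What the loop test says about the smallest eigenvalue modulus *)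

Section Accuracy.
Variables (R : realType) (n : nat) (A : 'M[R[i]]_n).
Hypotheses (Aherm : A \is hermsymmx) (n_gt0 : (0 < n)%N).

Lemma min_abs_spectrum_le (i : 'I_n) : min_abs_spectrum A <= `|(eigenvalues A)`_i|.
Proof.
have : (eigenvalues A)`_i \in eigenvalues A by rewrite mem_nth// size_eigenvalues.
rewrite mem_sort => /mapP [z zA ->].
rewrite -normc_real; last by have [] := hermitian_eigenvector _ _ _ Aherm _ zA.
by apply: seq_min_le; exact: map_f.
Qed.

Lemma min_abs_spectrum_mem :
  exists2 z, z \in spectrum A & min_abs_spectrum A = Normc.normc z.
Proof. by apply/mapP/seq_min_mem; rewrite size_map size_spectrum. Qed.

Lemma min_abs_spectrum_attained :
  exists i : 'I_n, min_abs_spectrum A = `|(eigenvalues A)`_i|.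
Proof.
have [z zA ->] := min_abs_spectrum_mem.
have : complex.Re z \in eigenvalues A by rewrite mem_sort map_f.
move=> /(nthP 0) [j jlt jE]; rewrite size_eigenvalues in jlt.
exists (Ordinal jlt); rewrite /= jE normc_real//.
by have [] := hermitian_eigenvector _ _ _ Aherm _ zA.
Qed.

Lemma min_abs_spectrum_bounds : A \in unitmx -> opnorm A <= 1 ->
  [/\ 0 < min_abs_spectrum A, min_abs_spectrum A <= 1
    & (min_abs_spectrum A)^-1 <= opnorm (invmx A)].
Proof.
move=> Aunit A1; have [z zA ->] := min_abs_spectrum_mem.
have [? ?] := inv_normc_spectrum_le_opnorm_invmx _ _ _ Aherm _ Aunit zA.
by split=> //; apply: le_trans (normc_spectrum_le_opnorm _ _ _ Aherm _ zA) A1.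
Qed.

(** At an index where the spectrum attains its smallest modulus, the matching sorted entry of [v] is
    off by at most [delta]. The converse bound uses an index where [v] attains its own minimum. *)
Lemma accurate_min_abs_le delta (v : n.-tuple R) : accurate A delta v ->
  min_abs v <= min_abs_spectrum A + delta.
Proof.
move=> acc; have [i ->] := min_abs_spectrum_attained.
apply: (@le_trans _ _ `|(sort <=%R v)`_i|).
  by apply/seq_min_le/map_f; rewrite -(mem_sort <=%R) mem_nth// size_sort size_tuple.
rewrite -[X in `|X| <= _](subrK (eigenvalues A)`_i) addrC.
exact: le_trans (ler_normD _ _) (lerD (lexx _) (acc i)).
Qed.

Lemma accurate_min_abs_ge delta (v : n.-tuple R) : accurate A delta v ->
  min_abs_spectrum A <= min_abs v + delta.
Proof.
move=> acc; have /mapP [x xv ->] : min_abs v \in [seq `|x| | x <- v].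
  by apply: seq_min_mem; rewrite size_map size_tuple.
move: xv; rewrite -(mem_sort <=%R) => /(nthP 0) [j].
rewrite size_sort size_tuple => jlt <-.
apply: le_trans (min_abs_spectrum_le (Ordinal jlt)) _.
rewrite -[X in `|X| <= _](subrK (sort <=%R v)`_j) addrC.
by apply: le_trans (ler_normD _ _) (lerD (lexx _) _); rewrite distrC; exact: acc (Ordinal jlt).
Qed.

(** With m the smallest modulus, [delta * (1 + eps) < eps * (m + delta)], and [eps * delta] cancels:
    this is why the test uses [eps / (1 + eps)]. *)
Lemma exit_test_accuracy (eps delta : R) (v : n.-tuple R) : 0 < eps ->
  accurate A delta v -> delta < eps / (1 + eps) * min_abs v ->
  delta < eps * min_abs_spectrum A.
Proof.
move=> eps0 /accurate_min_abs_le vle.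
rewrite mulrAC ltr_pdivlMr ?addr_gt0// => h.
have := ler_wpM2l (ltW eps0) vle; lra.
Qed.

(** Here [eps * m <= delta * (1 + 2 * eps)], and [eps < 1/2] bounds the last factor by 2. *)
Lemma continue_test_accuracy (eps delta : R) (v : n.-tuple R) : 0 < eps < 2^-1 ->
  accurate A delta v -> eps / (1 + eps) * min_abs v <= delta -> 0 < delta ->
  eps * min_abs_spectrum A <= delta * 2.
Proof.
move=> /andP [eps0 eps1] /accurate_min_abs_ge vge.
rewrite mulrAC ler_pdivrMr ?addr_gt0// => h d0.
have := ler_wpM2l (ltW eps0) vge.
have : delta * eps <= delta * 2^-1 by rewrite ler_wpM2l// ltW.
lra.
Qed.

End Accuracy.

(** * Number of calls, cost and termination of the loop *)

Section Loop.
Variables (R : realType) (S : Type) (EVALSH : eig_routine R S).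
Variables (n : nat) (u : R) (A : 'M[R[i]]_n) (eps : R) (xi : nat -> S).

Lemma evalsh_rel_loop_output k delta e :
  evalsh_rel_loop EVALSH u A eps xi k delta e ->
  exists2 delta', (delta', output e) \in calls e
    & delta' < eps / (1 + eps) * min_abs (output e).
Proof.
elim=> {k delta e} [k delta v c _ h|k delta v c e _ _ _ [d de dlt]] /=.
  by exists delta => //; rewrite mem_head.
by exists d => //; rewrite inE de orbT.
Qed.

(** A floor for the requested accuracies, kept abstract so that the loop analysis does not involve
    the spectrum. *)
Variable beta : R.
Hypothesis continue_ge : forall (delta : R) (v : n.-tuple R), 0 < delta ->
  accurate A delta v -> eps / (1 + eps) * min_abs v <= delta -> beta <= delta / 2.

(** With s calls the last accuracy is [delta / 2 ^+ (s - 1)], still at least [beta]. Each call costs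
    at most [B], plus one test and one halving; the halving is also charged to the last call. *)
Lemma evalsh_rel_loop_calls (B : R) k delta e :
  (forall s delta, 0 < delta <= 2^-1 -> beta <= delta ->
     (EVALSH n u A delta s).2%:R <= B) ->
  evalsh_rel_loop EVALSH u A eps xi k delta e -> successful A e ->
  0 < delta <= 2^-1 -> beta <= delta ->
  beta * 2 ^+ size (calls e) <= delta * 2 /\
  (ops e)%:R <= (size (calls e))%:R * (B + (test_ops n).+1%:R).
Proof.
move=> cost; elim=> {k delta e} [k delta v c ev h|k delta v c e ev h _ IH] /= succ d0 bd.
  have := cost (xi k) delta d0 bd; rewrite ev /= => cB.
  rewrite expr1 mul1r natrD; split; first by rewrite ler_pM2r.
  by rewrite lerD// ler_nat leqnSn.
have acc : accurate A delta v by apply: (succ (delta, v)); rewrite mem_head.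
have /andP [dgt0 dle] := d0.
have [|||IH1 IH2] := IH.
- by move=> c' c'e; apply: succ; rewrite inE c'e orbT.
- by lra.
- exact: continue_ge dgt0 acc h.
have := cost (xi k) delta d0 bd; rewrite ev /= => cB.
split; first by rewrite exprSr mulrA ler_pM2r// (le_trans IH1)// divfK.
rewrite natrD -addnA addn1 natrD -[(size _).+1%:R]natr1 mulrDl mul1r addrC.
exact: lerD IH2 (lerD cB (lexx _)).
Qed.

(** Induction on a number [j] of halvings that would bring the accuracy below [beta]: accurate calls
    never let the loop get there, so [j = 0] is contradictory. *)
Lemma evalsh_rel_loop_terminates j k delta : 0 < delta -> beta <= delta ->
  delta / 2 ^+ j < beta ->
  (forall i, (i < j)%N -> beta <= delta / 2 ^+ i ->
     accurate A (delta / 2 ^+ i) (EVALSH n u A (delta / 2 ^+ i) (xi (k + i))).1) ->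
  exists e, evalsh_rel_loop EVALSH u A eps xi k delta e /\ successful A e.
Proof.
elim: j k delta => [|j IH] k delta d0 bd; first by rewrite expr0 divr1 ltNge bd.
move=> jb acc; have := acc 0 isT; rewrite expr0 divr1 addn0 => /(_ bd).
case ev : (EVALSH n u A delta (xi k)) => [v c] /= accv.
have [h|h] := ltP delta (eps / (1 + eps) * min_abs v).
  exists (Execution v [:: (delta, v)] (c + test_ops n)%N); split.
    exact: Loop_exit.
  by move=> c'; rewrite inE => /eqP ->.
have d2E i : delta / 2 / 2 ^+ i = delta / 2 ^+ i.+1 by rewrite exprS invfM mulrA.
have [||||e [le se]] := IH k.+1 (delta / 2).
- by rewrite divr_gt0.
- exact: continue_ge d0 accv h.
- by rewrite d2E.
- by move=> i ij; rewrite d2E addSnnS; exact: acc.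
exists (Execution (output e) ((delta, v) :: calls e) (c + test_ops n + 1 + ops e)%N).
split; first exact: Loop_continue ev h le.
by move=> c' /predU1P [->|/se].
Qed.

End Loop.

(** * Union bound over the failure events *)

Lemma probability_bigcap_ge (R : realType) (d : measure_display)
    (T : measurableType d) (P : probability T R) (F : nat -> set T) (q : R) N :
  (forall i, measurable (F i)) -> (forall i, (((1 - q)%:E) <= P (F i))%E) ->
  with_prob_ge P (1 - q * N%:R) [set w | forall i, (i < N)%N -> F i w].
Proof.
move=> mF PF; elim: N => [|N [E [mE EF PE]]].
  by exists setT; split => //; rewrite mulr0 subr0 probability_setT.
exists (E `&` F N); split; first exact: measurableI.
  move=> w [/EF Ew Fw] i; rewrite ltnS leq_eqVlt => /predU1P [->//|]; exact: Ew.
have mI : measurable (E `&` F N) by exact: measurableI.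
(* Subadditivity on complements: the new event adds at most [q] to the failure probability. *)
have : (P (~` (E `&` F N)) <= P (~` E) + P (~` F N))%E.
  by rewrite setCI; apply: measureU2; exact: measurableC.
rewrite !probability_setC//.
have := PF N; move: PE.
rewrite -(fineK (fin_num_measure P _ mE)) -(fineK (fin_num_measure P _ (mF N))).
rewrite -(fineK (fin_num_measure P _ mI)) -!EFinB -EFinD !lee_fin -natr1.
lra.
Qed.

(** * Logarithmic estimates *)

Section Logarithms.
Variable R : realType.
Implicit Types x y : R.

Lemma ln2_gt0 : 0 < ln 2 :> R.
Proof. by rewrite ln_gt0// ltr1n. Qed.

(** Absorbs a constant 4 into a power, so that it costs only a factor 3 after taking logarithms. *)
Lemma le_4M_exp3 x : 2 <= x -> 4 * x <= x ^+ 3.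
Proof.
move=> x2; have : 2 * 2 <= x * x by apply: ler_pM.
by move=> xx; rewrite exprSr expr2 ler_wpM2r//; lra.
Qed.

Lemma ln_le_3ln x y : 2 <= x -> 0 < y -> y <= 4 * x -> ln y <= 3 * ln x.
Proof.
move=> x2 y0 yx; have x0 : 0 < x by lra.
have -> : 3 * ln x = ln (x ^+ 3) by rewrite lnXn// mulr_natl.
by rewrite ler_ln ?posrE ?exprn_gt0// (le_trans yx) ?le_4M_exp3.
Qed.

Lemma pow2_le_log x s : 2 <= x -> 2 ^+ s <= 4 * x -> s%:R <= 3 / ln 2 * ln x.
Proof.
move=> x2 sx; have := ln_le_3ln _ _ x2 (exprn_gt0 s (ltr0n R 2)) sx.
by rewrite lnXn ?ltr0n// (mulrAC 3) ler_pdivlMr ?ln2_gt0// (mulr_natl _ s).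
Qed.

Lemma pow2_gt_log x s : 2 <= x -> 3 / ln 2 * ln x < s%:R -> 4 * x < 2 ^+ s.
Proof.
move=> x2; have x0 : 0 < x by lra.
rewrite mulrAC ltr_pdivrMr ?ln2_gt0// (mulr_natl _ 3) (mulr_natl _ s) -!lnXn ?ltr0n//.
rewrite ltr_ln ?posrE ?exprn_gt0 ?ltr0n//.
exact: le_lt_trans (le_4M_exp3 _ x2).
Qed.

End Logarithms.

(** * Guarantees of the relative-accuracy algorithm *)

Theorem theorem4p3 (R : realType) (n0 : nat) (hn0 : (0 < n0)%N)
    (omega eta : R) (T_MM : nat -> R) (hT : mm_cost n0 omega eta T_MM)
    (d : measure_display) (S : measurableType d) (mu : probability S R)
    (EVALSH : eig_routine R S) (hE : evalsh_spec mu n0 T_MM EVALSH) :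
  exists Cops Cprob Cbits : R,
  forall (n : nat) (A : 'M[R[i]]_n) (eps u : R),
    (n0 <= n)%N ->
    A \is hermsymmx -> A \in unitmx -> opnorm A <= 1 ->
    0 < eps < 2^-1 -> 0 < u < 1 ->
    Cbits * (ln (n%:R * opnorm (invmx A) / eps) ^+ 4 * ln n%:R)
      <= precision_bits u ->
  forall (d' : measure_display) (Omega : measurableType d')
    (P : probability Omega R) (xi : nat -> Omega -> S),
    (forall k, measurable_fun setT (xi k)) ->
    (forall k (E : set S), measurable E -> P (xi k @^-1` E) = mu E) ->
  [/\ forall (w : Omega) (e : execution R n),
        evalsh_rel EVALSH u A eps (xi ^~ w) e -> successful A e ->
        forall i : 'I_n,
          `|(sort <=%R (output e))`_i - (eigenvalues A)`_i|
             <= eps * min_abs_spectrum A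
          /\ eps * min_abs_spectrum A <= eps * `|(eigenvalues A)`_i|,
      forall (w : Omega) (e : execution R n),
        evalsh_rel EVALSH u A eps (xi ^~ w) e -> successful A e ->
        (ops e)%:R <= Cops * (T_MM n
                              * ln (n%:R * opnorm (invmx A) / eps) ^+ 2
                              * ln (opnorm (invmx A) / eps)) &
      with_prob_ge P (1 - Cprob * (ln (opnorm (invmx A) / eps) / n%:R))
        [set w | exists e : execution R n,
                   evalsh_rel EVALSH u A eps (xi ^~ w) e /\ successful A e]].

Proof.
have [Co [Cb hEV]] := hE.
have [_ [C C0 hC]] := hT.
have l20 : 0 < ln 2 :> R := ln2_gt0 R.
(* The factors 9 and 81 are the powers 2 and 4 of the 3 in [ln (n / delta) <= 3 * M]; [3 / ln 2] and
   [4 / ln 2] bound the number of calls and the number of events in the union bound, relative to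
   [L]; the term in [C] pays for the loop tests. Absolute values cover possibly negative [Co] and
   [Cb]. *)
exists (3 / ln 2 * (9 * `|Co| + 6 * C / ln 2 ^+ 2)), (17 * (4 / ln 2)), (81 * `|Cb|).
move=> n A eps u n0n Aherm Aunit A1 epsP u01 prec d' Omega P xi mxi Pxi.
have n_gt0 : (0 < n)%N by exact: leq_trans n0n.
have n1 : 1 <= n%:R :> R by rewrite ler1n.
have [m0 m1 mK] := min_abs_spectrum_bounds _ _ _ Aherm n_gt0 Aunit A1.
have /andP [eps0 eps1] := epsP.
move: mK prec; set K := opnorm (invmx A); set m := min_abs_spectrum A in m0 m1 *.
move=> mK; rewrite -mulrA; set q := K / eps => prec.
have K1 : 1 <= K by apply: le_trans mK; rewrite invf_ge1.
have q2 : 2 <= q.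
  by rewrite ler_pdivlMr// (le_trans _ K1)//; lra.
have q0 : 0 < q by lra.
have nq2 : 2 <= n%:R * q by rewrite (le_trans q2)// ler_peMl// ltW.
have L2 : ln 2 <= ln q by rewrite ler_ln ?posrE// ltr0n.
have M2 : ln 2 <= ln (n%:R * q) by rewrite ler_ln ?posrE ?ltr0n//; lra.
set L := ln q in L2 *; set M := ln (n%:R * q) in prec M2 *.
have Tn : n%:R <= C * T_MM n by exact: hC.
have T0 : 0 < T_MM n by rewrite -(pmulr_rgt0 _ C0); lra.
(* This is [eps / (4 * K)]: one factor 2 comes from the failed test, the other from the halving
   after it. *)
pose beta : R := (4 * q)^-1.
have beta0 : 0 < beta by rewrite invr_gt0; lra.
have betaE : beta * (4 * q) = 1 by rewrite mulVf//; lra.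
have beta2 : beta <= 2^-1 by rewrite lef_pV2 ?posrE; lra.
have betam : beta * 4 <= eps * m.
  have -> : beta * 4 = eps * K^-1.
    by rewrite /beta /q; field; rewrite !gt_eqF//; lra.
  by rewrite ler_pM2l// -[leRHS]invrK lef_pV2 ?posrE ?invr_gt0//; lra.
have cont delta (v : n.-tuple R) : 0 < delta -> accurate A delta v ->
    eps / (1 + eps) * min_abs v <= delta -> beta <= delta / 2.
  move=> dgt0 acc h.
  have := continue_test_accuracy _ _ _ Aherm n_gt0 _ _ _ epsP acc h dgt0.
  by rewrite -/m; lra.
(* Above the floor, [n / delta] is at most [4 * (n * q)]. *)
have lnd delta : 0 < delta <= 2^-1 -> beta <= delta ->
    0 <= ln (n%:R / delta) <= 3 * M.
  move=> /andP [dgt0 dle] bd; apply/andP; split.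
    by rewrite ln_ge0// ler_pdivlMr//; lra.
  apply: ln_le_3ln => //; first by rewrite divr_gt0//; lra.
  rewrite ler_pdivrMr// mulrCA -mulrA ler_peMr//.
  by rewrite -[leLHS]betaE [leLHS]mulrC ler_wpM2l//; lra.
have spec delta : 0 < delta <= 2^-1 -> beta <= delta ->
    (forall s, (EVALSH n u A delta s).2%:R <= `|Co| * (T_MM n * (9 * M ^+ 2))) /\
    with_prob_ge mu (1 - 17 / n%:R) [set s | accurate A delta (EVALSH n u A delta s).1].
  move=> dP bd; have /andP [l0 lM] := lnd delta dP bd.
  have lp k : ln (n%:R / delta) ^+ k <= 3 ^+ k * M ^+ k.
    by rewrite -exprMn lerXn2r// nnegrE (le_trans l0).
  have lnn : 0 <= ln n%:R :> R by rewrite ln_ge0.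
  have [|cost pr] := hEV n A delta u n0n Aherm A1 dP u01.
    apply: le_trans prec; rewrite (mulrC 81) -(mulrA _ 81).
    apply: le_trans (ler_norm _) _; rewrite normrM ler_wpM2l//.
    rewrite ger0_norm ?mulr_ge0 ?exprn_ge0// (mulrA 81) ler_wpM2r//.
    by apply: le_trans (lp 4) _; rewrite -natrX.
  split=> // s; apply: le_trans (cost s) _.
  apply: le_trans (ler_norm _) _; rewrite normrM ler_wpM2l//.
  rewrite ger0_norm ?mulr_ge0 ?exprn_ge0 ?(ltW T0)// ler_pM2l//.
  by apply: le_trans (lp 2) _; rewrite -natrX.
have half : 0 < (2^-1 : R) <= 2^-1 by apply/andP; split; lra.
split.
- move=> w e run succ i.
  have [delta din dlt] := evalsh_rel_loop_output _ _ _ _ _ _ _ _ _ _ _ run.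
  have acc : accurate A delta (output e) := succ _ din.
  have := exit_test_accuracy _ _ _ Aherm n_gt0 _ _ _ eps0 acc dlt.
  split; first exact: le_trans (acc i) (ltW _).
  by rewrite ler_pM2l// min_abs_spectrum_le.
- move=> w e run succ.
  have [] := evalsh_rel_loop_calls _ _ _ _ _ _ _ _ _ cont
    (`|Co| * (T_MM n * (9 * M ^+ 2))) _ _ _
    (fun s delta dP bd => (spec delta dP bd).1 s) run succ half beta2.
  set s := size _; rewrite mulVf ?pnatr_eq0// => sb opsb.
  (* Starting from accuracy 1/2, the calls satisfy [2 ^+ s <= 1 / beta = 4 * q]. *)
  have sL : s%:R <= 3 / ln 2 * L.
    apply: pow2_le_log => //.
    by rewrite -[leRHS]mul1r -[4 * q]invrK -/beta ler_pdivlMr// mulrC.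
  apply: (le_trans opsb).
  have -> : 3 / ln 2 * (9 * `|Co| + 6 * C / ln 2 ^+ 2) * (T_MM n * M ^+ 2 * L)
          = 3 / ln 2 * L * (`|Co| * (T_MM n * (9 * M ^+ 2)) +
                            6 * (C * T_MM n) * (M / ln 2) ^+ 2).
    by field; rewrite gt_eqF.
  apply: ler_pM => //.
    by rewrite addr_ge0// !mulr_ge0 ?exprn_ge0// ?(ltW T0)//; lra.
  (* A test and a halving cost [2 * n + 4 <= 6 * n] operations, and [M / ln 2] is at least 1. *)
  rewrite lerD2l; apply: (@le_trans _ _ (6 * (C * T_MM n))); last first.
    rewrite ler_peMr//; first by lra.
    by rewrite exprn_ege1// ler_pdivlMr// mul1r.
  rewrite /test_ops -addnS natrD natrM; lra.
(* The successor makes [N] strictly exceed [3 / ln 2 * L], whence [2 ^+ N > 4 * q] and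
   [dk N < beta]. *)
- pose N := (Num.trunc (3 / ln 2 * L)).+1.
  pose dk i : R := 2^-1 / 2 ^+ i.
  have dkP i : 0 < dk i <= 2^-1.
    rewrite divr_gt0 ?invr_gt0 ?exprn_gt0 ?ltr0n//=.
    by rewrite ler_pdivrMr ?exprn_gt0 ?ltr0n// ler_peMr// exprn_ege1// ler1n.
  have /choice [F FP] : forall i, exists E : set S, [/\ measurable E,
      ((1 - 17 / n%:R)%:E <= mu E)%E &
      beta <= dk i -> forall s, E s -> accurate A (dk i) (EVALSH n u A (dk i) s).1].
    move=> i; have [bd|bd] := leP beta (dk i).
      by have [_ [E [mE Eacc PE]]] := spec _ (dkP i) bd; exists E.
    exists setT; split=> //.
    by rewrite probability_setT lee_fin gerBl divr_ge0.
  have [||E [mE EF PE]] := probability_bigcap_ge _ _ _ P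
      (fun i => xi i @^-1` F i) (17 / n%:R) N.
  + by move=> i; rewrite -[X in measurable X]setTI; apply: mxi => //; have [] := FP i.
  + by move=> i; have [mF ? _] := FP i; rewrite Pxi.
  exists E; split=> // [w /EF Fw|].
    apply: (evalsh_rel_loop_terminates _ _ _ _ _ _ _ _ _ cont N) => //.
    - rewrite -/(dk N) -[dk N]invrK /beta ltf_pV2 ?posrE ?invr_gt0//;
        [|by have /andP [] := dkP N|by lra].
      rewrite /dk invfM !invrK; apply: lt_le_trans (pow2_gt_log _ _ N q2 _) _.
        exact: truncnS_gt.
      by rewrite ler_peMl// ?exprn_ge0// ler1n.
    - by move=> i iN bd; have [_ _ Facc] := FP i; rewrite add0n; apply: Facc (Fw _ iN).
  apply: le_trans PE; rewrite lee_fin lerD2l lerN2.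
  (* The extra 1 in [N] is absorbed using [ln 2 <= L]. *)
  have NL : N%:R <= 4 / ln 2 * L.
    have : (Num.trunc (3 / ln 2 * L))%:R <= 3 / ln 2 * L.
      by rewrite truncn_le !mulr_ge0 ?invr_ge0//; lra.
    have : 1 <= (ln 2)^-1 * L by rewrite mulrC ler_pdivlMr// mul1r.
    rewrite /N -natr1; lra.
  have -> : 17 * (4 / ln 2) * (L / n%:R) = 17 / n%:R * (4 / ln 2 * L) by ring.
  by rewrite ler_wpM2l// divr_ge0.
Qed.
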